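(* Let $G$ be a groupoid on a topological space $X$, let $H\in L_G(X)$ be a wide subgroupoid of $G$, and let $s$ be the local subgroupoid $s=loc(H)$ of $G$. Suppose that for every $x\in X$ there is an open neighbourhood $W_x$ of $x$ such that $H|W_x$ has connected transitivity components. Then $s$ is coherent.
   Context: $X$ is a topological space and $G$ is a groupoid on $X$, i.e. an (abstract) groupoid with object set $X$. For an open set $U\subseteq X$, $G|U$ is the full subgroupoid of $G$ on the objects in $U$, and $L_G(U)$ is the set of all wide subgroupoids of $G|U$ (subgroupoids having all points of $U$ as objects). For $V\subseteq U$ open and $H\in L_G(U)$, $H|V\in L_G(V)$ is the full subgroupoid of $H$ on $V$; this makes $L_G$ a presheaf on $X$. Let $\mathcal{L}_G\to X$ be the associated sheaf (space of germs). The germ at $x\in U$ of $H\in L_G(U)$ is written $(U,H)_x$; thus $(U,H)_x=(V,K)_x$ iff $H|W=K|W$ for some open $W$ with $x\in W\subseteq U\cap V$. A local subgroupoid of $G$ is a global section $s:X\to\mathcal{L}_G$. Partial order: on germs at $x$, $(U',H')_x\leq(U,H)_x$ iff there is an open $W$ with $x\in W\subseteq U\cap U'$ and $H'|W$ a subgroupoid of $H|W$; for local subgroupoids, $s\leq t$ iff $s(x)\leq t(x)$ for all $x\in X$. For a wide subgroupoid $H$ of $G$, $loc(H)$ is the local subgroupoid $x\mapsto (X,H)_x$. For a local subgroupoid $s$ of $G$, $glob(s)$ is the wide subgroupoid of $G$ that is the intersection of all wide subgroupoids $H$ of $G$ with $s\leq loc(H)$. A local subgroupoid $s$ is coherent if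 $s\leq loc(glob(s))$. The transitivity component of $x$ in a groupoid $K$ on a set $U$ is the set of all $y\in U$ such that $K(x,y)$, the set of morphisms of $K$ from $x$ to $y$, is non-empty. For $U\subseteq X$, transitivity components carry the subspace topology from $X$. *)

(* Defs.v *)
From HB Require Import structures.
From mathcomp Require Import all_boot.
From mathcomp Require Import boolp classical_sets topology.

Set Implicit Arguments.
Unset Strict Implicit.
Unset Printing Implicit Defensive.

Local Open Scope classical_set_scope.
Local Open Scope quotient_scope.

#[local] Obligation Tactic := idtac.

(* Composition is written in diagrammatic order:
   [gcomp f g] is first [f : x -> y], then [g : y -> z]. *)
Record groupoid (X : Type) := Groupoid {
  ghom :> X -> X -> Type;
  gid : forall x, ghom x x;
  gcomp : forall x y z, ghom x y -> ghom y z -> ghom x z;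
  ginv : forall x y, ghom x y -> ghom y x;
  gcompA : forall x y z t (f : ghom x y) (g : ghom y z) (h : ghom z t),
    gcomp f (gcomp g h) = gcomp (gcomp f g) h;
  gcomp1g : forall x y (f : ghom x y), gcomp (gid x) f = f;
  gcompg1 : forall x y (f : ghom x y), gcomp f (gid y) = f;
  gcompgV : forall x y (f : ghom x y), gcomp f (ginv f) = gid x;
  gcompVg : forall x y (f : ghom x y), gcomp (ginv f) f = gid y
}.

Section Subgroupoids.
Variables (X : Type) (G : groupoid X).

Record subgroupoid := Subgroupoid {
  sobj : set X;
  sarr : forall x y, set (G x y);
  sarr_obj : forall x y (f : G x y), sarr f -> sobj x /\ sobj y;
  sarr1 : forall x, sobj x -> sarr (gid G x);
  sarrM : forall x y z (f : G x y) (g : G y z),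
    sarr f -> sarr g -> sarr (gcomp f g);
  sarrV : forall x y (f : G x y), sarr f -> sarr (ginv f)
}.

Lemma subgroupoidP (H K : subgroupoid) : sobj H = sobj K ->
  (forall x y (f : G x y), sarr H f <-> sarr K f) -> H = K.
Proof.
case: H K => [oH aH H1 H2 H3 H4] [oK aK K1 K2 K3 K4] /= eo ea.
subst oK; have ea' : aH = aK.
  apply: functional_extensionality_dep => x.
  apply: functional_extensionality_dep => y.
  by apply/funext => f; apply/propext; exact: ea.
by subst aK; congr Subgroupoid; exact: Prop_irrelevance.
Qed.

Definition subgpd_le (H K : subgroupoid) : Prop :=
  sobj H `<=` sobj K /\ forall x y (f : G x y), sarr H f -> sarr K f.

Definition total_subgpd : subgroupoid :=
  @Subgroupoid setT (fun x y => setT)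
    (fun _ _ _ _ => conj I I) (fun _ _ => I)
    (fun _ _ _ _ _ _ _ => I) (fun _ _ _ _ => I).

(* [full H V] is H|V, the full subgroupoid of [H] on the objects in [V]. *)
Program Definition full (H : subgroupoid) (V : set X) : subgroupoid :=
  @Subgroupoid (sobj H `&` V)
    (fun x y => [set f | [/\ sarr H f, V x & V y]]) _ _ _ _.
Next Obligation.
by move=> H V x y f [/sarr_obj[]].
Qed.
Next Obligation.
by move=> H V x [Hx Vx]; split => //; exact: sarr1.
Qed.
Next Obligation.
by move=> H V x y z f g [Hf Vx Vy] [Hg _ Vz]; split => //; exact: sarrM.
Qed.
Next Obligation.
by move=> H V x y f [Hf Vx Vy]; split => //; exact: sarrV.
Qed.

Lemma full_full H (V W : set X) : full (full H V) W = full H (V `&` W).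
Proof.
apply: subgroupoidP => /= [|x y f]; first by rewrite setIA.
by split=> [[[] *]|[? [] ? ? []]].
Qed.

(* [wide_on U] is L_G(U): the wide subgroupoids of G|U. *)
Record wide_on (U : set X) := WideOn {
  wsub :> subgroupoid;
  wsub_le : subgpd_le wsub (full total_subgpd U);
  wsub_obj : sobj wsub = U
}.

Program Definition wrestr (U V : set X) (VU : V `<=` U) (H : wide_on U) :
  wide_on V := @WideOn V (full H V) _ _.
Next Obligation.
move=> U V VU H; split=> /= [x []//|x y f []//].
Qed.
Next Obligation.
by move=> U V VU H /=; rewrite wsub_obj; apply/setIidPr.
Qed.

(* On the empty family this is the total subgroupoid. *)
Program Definition subgpd_meet (F : set subgroupoid) : subgroupoid :=
  @Subgroupoid (\bigcap_(H in F) sobj H)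
    (fun x y => [set f | forall H, F H -> sarr H f]) _ _ _ _.
Next Obligation.
by move=> F x y f Ff; split=> H /Ff /sarr_obj[].
Qed.
Next Obligation. by move=> F x Fx H FH; apply: sarr1; exact: Fx. Qed.
Next Obligation.
by move=> F x y z f g Ff Fg H FH; apply: sarrM; [exact: Ff|exact: Fg].
Qed.
Next Obligation. by move=> F x y f Ff H FH; apply: sarrV; exact: Ff. Qed.

Definition transitivity_component (K : subgroupoid) (x : X) : set X :=
  [set y | sobj K y /\ exists f : G x y, sarr K f].

End Subgroupoids.

Definition connected_transitivity_components (X : topologicalType)
    (G : groupoid X) (K : subgroupoid G) : Prop :=
  forall x, sobj K x -> connected (transitivity_component K x).

Section LocalSubgroupoids.
Variables (X : topologicalType) (G : groupoid X).

(* Representatives (U, H, x) of germs, with x in U open and H in L_G(U). *)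
Record pregerm := Pregerm {
  pg_dom : set X;
  pg_open : open pg_dom;
  pg_sub : wide_on G pg_dom;
  pg_pt : X;
  pg_ptP : pg_dom pg_pt
}.

HB.instance Definition _ := gen_eqMixin pregerm.
HB.instance Definition _ := gen_choiceMixin pregerm.

Definition pregerm_eq (a b : pregerm) : Prop :=
  pg_pt a = pg_pt b /\
  exists W : set X, [/\ open W, W (pg_pt a), W `<=` pg_dom a `&` pg_dom b
    & full (pg_sub a) W = full (pg_sub b) W].

Definition pregerm_le (a b : pregerm) : Prop :=
  pg_pt a = pg_pt b /\
  exists W : set X, [/\ open W, W (pg_pt a), W `<=` pg_dom a `&` pg_dom b
    & subgpd_le (full (pg_sub a) W) (full (pg_sub b) W)].

Definition pregerm_eqb (a b : pregerm) : bool := `[< pregerm_eq a b >].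

Lemma pregerm_eq_refl : reflexive pregerm_eqb.
Proof.
move=> [U oU H x Ux]; apply/asboolP; split=> //.
by exists U; split => //= y.
Qed.

Lemma pregerm_eq_sym : symmetric pregerm_eqb.
Proof.
suff h a b : pregerm_eq a b -> pregerm_eq b a.
  by move=> a b; apply/asboolP/asboolP; exact: h.
move=> [e [W [oW Wa sW eW]]]; split; first by rewrite e.
by exists W; split => //; [rewrite -e|rewrite setIC].
Qed.

Lemma full_sub (H K : subgroupoid G) (V W : set X) : W `<=` V ->
  full H V = full K V -> full H W = full K W.
Proof.
by move=> /setIidPr VW e; have := full_full H V W; rewrite e full_full VW.
Qed.

Lemma pregerm_eq_trans : transitive pregerm_eqb.
Proof.
move=> b a c /asboolP[e [W [oW Wa sW eW]]] /asboolP[f [V [oV Vb sV eV]]].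
apply/asboolP; split; first by rewrite e.
exists (W `&` V); split.
- exact: openI.
- by split => //; rewrite e.
- by move=> y [/sW[? _] /sV[]].
- rewrite (full_sub _ eW); last exact: subIsetl.
  by rewrite (full_sub _ eV) //; exact: subIsetr.
Qed.

Canonical pregerm_equiv :=
  EquivRel pregerm_eqb pregerm_eq_refl pregerm_eq_sym pregerm_eq_trans.

(* The set underlying the space of germs; its elements are germs at all
   points of X, [germ_pt] being the projection to X. *)
Definition germs := {eq_quot pregerm_equiv}.

HB.instance Definition _ := Choice.on germs.
HB.instance Definition _ := Quotient.on germs.

Definition germ (U : set X) (oU : open U) (H : wide_on G U) (x : X)
  (Ux : U x) : germs := \pi_germs (Pregerm oU H Ux).

Lemma pi_germsE a b : \pi_germs a = \pi_germs b <-> pregerm_eq a b.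
Proof. by split=> [/eqmodP/asboolP|h]; last exact/eqmodP/asboolP. Qed.

Lemma germE (U V : set X) (oU : open U) (oV : open V) (H : wide_on G U)
    (K : wide_on G V) (x : X) (Ux : U x) (Vx : V x) :
  germ oU H Ux = germ oV K Vx <->
  exists W : set X, [/\ open W, W x, W `<=` U `&` V & full H W = full K W].
Proof. by split=> [/pi_germsE[]|h]; last exact/pi_germsE. Qed.

Definition germ_pt (e : germs) : X := pg_pt (repr e).

Lemma germ_pt_pi a : germ_pt (\pi_germs a) = pg_pt a.
Proof.
by have /pi_germsE[] : \pi_germs (repr (\pi_germs a)) = \pi_germs a
  by rewrite reprK.
Qed.

Definition germ_le (e' e : germs) : Prop := pregerm_le (repr e') (repr e).

Lemma pregerm_le_eq a a' b b' : pregerm_eq a a' -> pregerm_eq b b' ->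
  pregerm_le a b -> pregerm_le a' b'.
Proof.
move=> [ea [V [oV Va sV eV]]] [eb [W [oW Wb sW eW]]].
move=> [eab [Z [oZ Za sZ leZ]]]; split; first by rewrite -ea eab.
exists (V `&` W `&` Z); split.
- by apply: openI => //; exact: openI.
- by rewrite -ea; do 2?split => //; rewrite eab.
- by move=> y [[/sV[_ ?] /sW[]]].
- have e1 : full (pg_sub a') (V `&` W `&` Z) = full (pg_sub a) (V `&` W `&` Z).
    by apply/esym/(full_sub _ eV) => y [[]].
  have e2 : full (pg_sub b') (V `&` W `&` Z) = full (pg_sub b) (V `&` W `&` Z).
    by apply/esym/(full_sub _ eW) => y [[]].
  rewrite e1 e2; case: leZ => /= lo la; split=> /=.
    by move=> y [oy vwz]; split => //; case: (lo y) => //; split => //; case: vwz.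
  move=> x y f [af vx vy]; split => //.
  by case: (la x y f) => //; split => //; [case: vx|case: vy].
Qed.

Lemma germ_le_pi a b : germ_le (\pi_germs a) (\pi_germs b) <-> pregerm_le a b.
Proof.
have h c : pregerm_eq (repr (\pi_germs c)) c by apply/pi_germsE; rewrite reprK.
have h' c : pregerm_eq c (repr (\pi_germs c)) by apply/pi_germsE; rewrite reprK.
by split; apply: pregerm_le_eq.
Qed.

(* The images of the local sections x |-> (U, H)_x are the basic open sets. *)
Definition germ_section (U : set X) (oU : open U) (H : wide_on G U) :
  set germs := [set e | exists (x : X) (Ux : U x), e = germ oU H Ux].

Definition germs_open (A : set germs) : Prop :=
  forall e, A e -> exists (U : set X) (oU : open U) (H : wide_on G U),
    germ_section oU H e /\ germ_section oU H `<=` A.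

Lemma germs_openT : germs_open setT.
Proof.
move=> e _; rewrite -[e]reprK; case: (repr e) => U oU H x Ux.
by exists U, oU, H; split => //; exists x, Ux.
Qed.

Lemma germs_openI A B : germs_open A -> germs_open B -> germs_open (A `&` B).
Proof.
move=> oA oB e [/oA[U [oU [H [[x [Ux ->]] sA]]]]].
move=> /oB[V [oV [K [[y [Vy /[dup] /pi_germsE[/= xy _]]]]]]]; subst y.
move=> /germE[W [oW Wx sW eW]] sB.
have WU : W `<=` U by move=> z /sW[].
have WV : W `<=` V by move=> z /sW[].
exists W, oW, (wrestr WU H); split.
  exists x, Wx; apply/germE; exists W; split => // [z Wz|].
    by split => //; exact: WU.
  by rewrite /= full_full setIid.
move=> _ [z [Wz ->]]; split.
  apply: sA; exists z, (WU _ Wz); apply/germE; exists W; split => // [t Wt|].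
    by split => //; exact: WU.
  by rewrite /= full_full setIid.
apply: sB; exists z, (WV _ Wz); apply/germE; exists W; split => // [t Wt|].
  by split => //; exact: WV.
by rewrite /= full_full setIid.
Qed.

Lemma germs_open_bigU (I : Type) (f : I -> set germs) :
  (forall i, germs_open (f i)) -> germs_open (\bigcup_i f i).
Proof.
move=> of_ e [i _ /of_[U [oU [H [He sH]]]]].
by exists U, oU, H; split => // z /sH ?; exists i.
Qed.

HB.instance Definition _ := @isOpenTopological.Build germs germs_open
  germs_openT germs_openI germs_open_bigU.

Record local_subgroupoid := LocalSubgroupoid {
  ls_fun :> X -> germs;
  ls_continuous : continuous ls_fun;
  ls_pt : forall x, germ_pt (ls_fun x) = x
}.

Definition local_le (s t : local_subgroupoid) : Prop :=
  forall x, germ_le (s x) (t x).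

Definition loc_fun (H : wide_on G setT) (x : X) : germs :=
  germ openT H (I : [set: X] x).

Lemma loc_continuous H : continuous (loc_fun H).
Proof.
apply/continuousP => A oA; rewrite openE => x /= Ax; rewrite /interior nbhsE.
have oA' : germs_open A by [].
have [U [oU [K [[y [Uy e]] sA]]]] := oA' _ Ax.
have xy : x = y by have /pi_germsE[] := e.
subst y; move: e => /germE[W [oW Wx sW eW]].
exists W; first by split.
move=> z Wz; apply: sA; have [_ Uz] := sW _ Wz.
by exists z, Uz; apply/germE; exists W.
Qed.

Lemma loc_pt H x : germ_pt (loc_fun H x) = x.
Proof. exact: germ_pt_pi. Qed.

Definition loc (H : wide_on G setT) : local_subgroupoid :=
  LocalSubgroupoid (@loc_continuous H) (loc_pt H).

Program Definition glob (s : local_subgroupoid) : wide_on G setT :=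
  @WideOn _ G setT
    (subgpd_meet [set K : subgroupoid G | exists H : wide_on G setT,
       K = H /\ local_le s (loc H)]) _ _.
Next Obligation. by []. Qed.
Next Obligation.
move=> s /=; apply/seteqP; split=> // x _ _ [H [-> _]].
by rewrite wsub_obj.
Qed.

Definition coherent (s : local_subgroupoid) : Prop :=
  local_le s (loc (glob s)).

End LocalSubgroupoids.

(* Main.v *)
Require Import Defs.
From mathcomp Require Import all_boot boolp classical_sets topology.

(** Let [K] be a wide subgroupoid with [loc H <= loc K]: around each point there
is an open set on which the arrows of [H] belong to [K].  As [glob (loc H)] is the
intersection of all such [K], coherence asks that around each [x] a single open
set serve all of them at once, and the given [W] with connected transitivity
components does.

To see this, fix [a] in [W], let [C] be its transitivity component in [H|W], and
consider the condition on [y] in [C] that every arrow of [H] from [a] to [y]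
belongs to [K].  It holds at [a], since the loops of [H] at [a] are arrows of [H]
near [a].  It passes between any two points [y], [z] of [C] that are close
enough to each other: given [g : a -> z] in [H], choose [h : a -> y] in [H|W] and
write [g] as [h] followed by [h^-1 g]; the first factor is in [K] by assumption
and the second one because it joins two neighbouring points.  A condition that
spreads locally in this sense, uniformly around every point, holds at all points
of a connected set or at none ([connected_spread]), so it holds on all of [C],
and every arrow of [H|W] lies in [K] ([full_arrows_sub]). *)

Set Implicit Arguments.
Unset Strict Implicit.
Unset Printing Implicit Defensive.

Local Open Scope classical_set_scope.

(** Spreading in both directions around every point of [C], including the points
where [P] fails, makes [P] relatively closed as well as relatively open. *)
Lemma connected_spread (X : topologicalType) (C P : set X) (a : X) :
  connected C -> C a -> P a ->
  (forall z, C z -> exists V, open_nbhs z V /\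
     forall y y', C y -> C y' -> V y -> V y' -> P y -> P y') ->
  C `<=` P.
Proof.
move=> cC Ca Pa spread.
suff /setIidPl : C `&` P = C by [].
apply: cC; first by exists a.
- exists (\bigcup_(V in [set V | open V /\ C `&` V `<=` P]) V).
    by apply: bigcup_open => V [].
  apply/seteqP; split=> [z [Cz Pz]|z [Cz [V [_ sV] Vz]]].
    have [V [[oV Vz] sV]] := spread _ Cz.
    split=> //; exists V => //; split=> // y [Cy Vy].
    exact: sV Pz.
  by split=> //; exact: sV.
- exists (~` \bigcup_(V in [set V | open V /\ C `&` V `<=` ~` P]) V).
    by apply: open_closedC; apply: bigcup_open => V [].
  apply/seteqP; split=> [z [Cz Pz]|z [Cz nVz]].
    by split=> // -[V [_ sV] Vz]; exact: sV Pz.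
  split=> //; apply: contrapT => nPz; apply: nVz.
  have [V [[oV Vz] sV]] := spread _ Cz.
  exists V => //; split=> // y [Cy Vy] Py; apply: nPz.
  exact: sV Py.
Qed.

Lemma local_le_locP (X : topologicalType) (G : groupoid X)
    (H K : wide_on G setT) :
  local_le (loc H) (loc K) <->
  forall x, exists V, open_nbhs x V /\ subgpd_le (full H V) (full K V).
Proof.
split=> h x.
  have /germ_le_pi[_ [V [/= oV Vx _ HK]]] := h x.
  by exists V.
apply/germ_le_pi; split=> //=; have [V [[oV Vx] HK]] := h x.
by exists V; split.
Qed.

(** The conclusion concerns the same [W] for every [K], although the
neighbourhoods that witness [loc H <= loc K] shrink with [K]: connectedness
replaces the missing uniformity. *)
Lemma full_arrows_sub (X : topologicalType) (G : groupoid X)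
    (H K : wide_on G setT) (W : set X) :
  connected_transitivity_components (full H W) ->
  local_le (loc H) (loc K) ->
  forall x y (f : G x y), sarr (full H W) f -> sarr K f.
Proof.
move=> cW /local_le_locP HK a b f Wf.
have [oa ob] := sarr_obj Wf; have [Hf Wa Wb] := Wf.
have near z : exists V, open_nbhs z V /\
    forall y y' (g : G y y'), V y -> V y' -> sarr H g -> sarr K g.
  have [V [Vz [_ sV]]] := HK z; exists V; split=> // y y' g Vy Vy' Hg.
  by have [] := sV _ _ g (And3 Hg Vy Vy').
pose P := [set y | forall g : G a y, sarr H g -> sarr K g].
suff /(_ b) PC : transitivity_component (full H W) a `<=` P.
  by apply: PC Hf; split=> //; exists f.
apply: (connected_spread (a := a)) => [| | |z _].
- exact: cW.
- by split=> //; exists (gid G a); exact: sarr1.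
- by have [V [[_ Va] sV]] := near a; move=> g; exact: sV.
- have [V [Vz sV]] := near z; exists V; split=> //.
  move=> y y' [_ [h [Hh _ _]]] _ Vy Vy' Py g Hg.
  (* [g] is [h] followed by [h^-1 g : y -> y'], whose ends both lie in [V]. *)
  rewrite -[g]gcomp1g -(gcompgV h) -gcompA.
  apply: sarrM; first exact: Py.
  by apply: sV => //; apply: sarrM => //; exact: sarrV.
Qed.

Theorem theorem2p9 (X : topologicalType) (G : groupoid X)
    (H : wide_on G [set: X]%classic) (s : local_subgroupoid G)
    (hs : s = loc H)
    (hH : forall x : X, exists W : set X, open_nbhs x W /\
       connected_transitivity_components (full H W)) :
  coherent s.
Proof.
subst s; apply/local_le_locP => x; have [W [Wx cW]] := hH x.
exists W; split=> //; split=> [y [_ Wy]|a b f Wf].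
  by split=> //; rewrite wsub_obj.
have [_ Wa Wb] := Wf; split=> // _ [K [-> HK]].
exact: full_arrows_sub Wf.
Qed.
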